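(* Let $d\geq 2$, let $\Lambda\subset\mathbb{R}^d$ be a unimodular lattice with dual lattice $\Lambda^\ast$. Then for every admissible function $f$ on $\mathcal{T}$, with $f^\ast(\pmb\tau)=f(-\pmb\tau)$, we have \[\underline{\Psi}_1(\Lambda,f)\leq\frac{\underline{\Psi}_1(\Lambda^\ast,f^\ast)}{d-1}.\]
   Context: $|\cdot|$ denotes the sup-norm on $\mathbb{R}^d$, and $\mathcal{B}=\{\vec x\in\mathbb{R}^d: |\vec x|\leq 1\}$. Let $\mathcal{T}=\{\pmb\tau=(\tau_1,\ldots,\tau_d)\in\mathbb{R}^d:\ \tau_1+\ldots+\tau_d=0\}$. For $\pmb\tau\in\mathcal{T}$ put $D_{\pmb\tau}=\mathrm{diag}(e^{\tau_1},\ldots,e^{\tau_d})$ and $\mathcal{B}_{\pmb\tau}=D_{\pmb\tau}\mathcal{B}$. For a lattice $\Gamma$, $\lambda_1(\mathcal{B}_{\pmb\tau},\Gamma)$ is the infimum of $\lambda>0$ such that $\lambda\mathcal{B}_{\pmb\tau}$ contains a nonzero vector of $\Gamma$, and $L_1(\pmb\tau,\Gamma)=\log\lambda_1(\mathcal{B}_{\pmb\tau},\Gamma)$. An admissible function is a non-negative function $f$ on $\mathcal{T}$ such that the sets $\{\pmb\tau\in\mathcal{T}: f(\pmb\tau)\leq\lambda\}$ form a monotone exhaustion of $\mathcal{T}$; in particular $|\pmb\tau|\to\infty$ if and only if $f(\pmb\tau)\to\infty$. For such $f$, $\underline{\Psi}_1(\Gamma,f)=\liminf_{|\pmb\tau|\to\infty,\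 \pmb\tau\in\mathcal{T}}L_1(\pmb\tau,\Gamma)/f(\pmb\tau)$. The dual lattice is $\Lambda^\ast=\{\vec y\in\mathbb{R}^d:\ \langle\vec y,\vec x\rangle\in\mathbb{Z}\text{ for all }\vec x\in\Lambda\}$. A lattice is unimodular if its covolume is $1$. *)

(* Defs.v *)
From HB Require Import structures.
From mathcomp Require Import all_boot all_order all_algebra.
From mathcomp Require Import all_classical all_reals all_analysis.

Set Implicit Arguments.
Unset Strict Implicit.
Unset Printing Implicit Defensive.

Import Order.TTheory GRing.Theory Num.Theory.
Import numFieldNormedType.Exports.

Local Open Scope classical_set_scope.
Local Open Scope ring_scope.

Section lattices.
Context {R : realType} {d : nat}.
Implicit Types (L : set 'rV[R]_d) (B : 'M[R]_d).

(* The rows of [B] are linearly independent and their integer combinations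
   are exactly the elements of [L]. *)
Definition lattice_basis B L : Prop :=
  B \in unitmx /\ L = [set map_mx intr z *m B | z in [set: 'rV[int]_d]].

Definition is_lattice L : Prop := exists B, lattice_basis B L.

(* By [covolumeE] below, the value does not depend on the basis picked. *)
Definition covolume L : R := `|\det (xget 0 [set B | lattice_basis B L])|.

Definition unimodular L : Prop := is_lattice L /\ covolume L = 1.

Definition dual_lattice L : set 'rV[R]_d :=
  [set y | forall x, L x -> \sum_i y 0 i * x 0 i \is a Num.int].

Lemma lattice_basis_trans B B' L : lattice_basis B L -> lattice_basis B' L ->
  exists U : 'M[int]_d, B = map_mx intr U *m B'.
Proof.
move=> [_ LB] [_ LB'].
have /choice[u uP] : forall i, exists z : 'rV[int]_d,
    row i B = map_mx intr z *m B'.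
  move=> i; have : L (row i B).
    rewrite LB; exists (delta_mx 0 i) => //.
    by rewrite map_delta_mx rowE.
  by rewrite LB' => -[z _ <-]; exists z.
exists (\matrix_i u i); apply/row_matrixP => i.
by rewrite uP row_mul -map_row rowK.
Qed.

Lemma covolumeE B L : lattice_basis B L -> covolume L = `|\det B|.
Proof.
move=> BL; rewrite /covolume; case: xgetP => [B' _ /= B'L|/(_ _ BL)//].
have [U BU] := lattice_basis_trans BL B'L.
have [V B'V] := lattice_basis_trans B'L BL.
have le1 (C C' : 'M[R]_d) (W : 'M[int]_d) : C \in unitmx ->
    C = map_mx intr W *m C' -> `|\det C'| <= `|\det C|.
  move=> Cu CW; rewrite CW det_mulmx normrM det_map_mx ler_peMl//.
  have : \det C != 0 by move: Cu; rewrite unitmxE unitfE.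
  rewrite CW det_mulmx det_map_mx mulf_eq0 intr_eq0 negb_or => /andP[W0 _].
  by rewrite -intr_norm ler1z -gtz0_ge1 normr_gt0.
apply/eqP; rewrite eq_le.
by rewrite (le1 _ _ _ BL.1 BU) (le1 _ _ _ B'L.1 B'V).
Qed.

End lattices.

Section parametric_minima.
Context {R : realType} {d : nat}.
Implicit Types (tau : 'rV[R]_d) (L : set 'rV[R]_d) (f : 'rV[R]_d -> R).

Definition T_space : set 'rV[R]_d := [set tau | \sum_i tau 0 i = 0].

(* The norm of ['rV[R]_d] is the sup-norm. *)
Definition unit_box : set 'rV[R]_d := [set x | `|x| <= 1].

Definition D_mx tau : 'M[R]_d := diag_mx (map_mx expR tau).

Definition box tau : set 'rV[R]_d := [set x *m D_mx tau | x in unit_box].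

Definition lambda1 (K L : set 'rV[R]_d) : R :=
  inf [set l | 0 < l /\ exists v, [/\ L v, v != 0 & [set l *: x | x in K] v]].

Definition L1 tau L : R := ln (lambda1 (box tau) L).

(* The filter of |tau| -> oo, tau in T_space. *)
Definition T_infty : set_system 'rV[R]_d :=
  filter_from [set: R] (fun M => [set tau | T_space tau /\ M < `|tau|]).

(* An increasing family of bounded sets which absorbs every bounded subset of
   T_space; in particular its union is T_space. Requiring only that the union
   be T_space would allow f to be unbounded on bounded sets. *)
Definition monotone_exhaustion (K : R -> set 'rV[R]_d) : Prop :=
  [/\ forall l m, l <= m -> K l `<=` K m,
      forall l, K l `<=` T_space,
      forall l, bounded_set (K l) &
      forall A, A `<=` T_space -> bounded_set A -> exists l, A `<=` K l].

(* Functions on T_space are functions on R^d whose values outside T_space are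
   never used. *)
Definition admissible f : Prop :=
  (forall tau, T_space tau -> 0 <= f tau) /\
  monotone_exhaustion (fun l => [set tau | T_space tau /\ f tau <= l]).

(* |tau| -> oo if and only if f tau -> oo. *)
Lemma admissibleP f : admissible f <->
  [/\ forall tau, T_space tau -> 0 <= f tau,
      forall l, exists M, forall tau, T_space tau -> M < `|tau| -> l < f tau &
      forall M, exists l, forall tau, T_space tau -> l < f tau -> M < `|tau|].
Proof.
split=> [[f0 [_ _ fb fa]]|[f0 fb fa]]; split => //.
- move=> l; have [M [_ /(_ (M + 1))MP]] := fb l; exists (M + 1) => tau Ttau Mtau.
  rewrite ltNge; apply/negP => ftau; move: Mtau; apply/negP; rewrite -leNgt.
  by apply: MP; rewrite ?ltrDl//; split.
- move=> M; have [||l lP] := fa [set tau | T_space tau /\ `|tau| <= M].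
  + by move=> tau [].
  + exists M; split; first exact: num_real.
    by move=> N MN tau /= [_ /le_trans]; apply; exact: ltW.
  exists l => tau Ttau; rewrite !ltNge; apply: contra => tauM.
  by have [] := lP tau (conj Ttau tauM).
- split.
  + by move=> l m lm tau /= [Ttau ftau]; split=> //; exact: le_trans lm.
  + by move=> l tau [].
  + move=> l; have [M MP] := fb l; exists M; split; first exact: num_real.
    move=> N MN tau /= [Ttau ftau]; rewrite leNgt; apply/negP => Ntau.
    by have := MP _ Ttau (lt_trans MN Ntau); rewrite ltNge ftau.
  + move=> A AT [M [_ /(_ (M + 1))MP]]; have [l lP] := fa (M + 1).
    exists l => tau Atau; split; first exact: AT.
    rewrite leNgt; apply/negP => /(lP _ (AT _ Atau)); apply/negP.
    by rewrite -leNgt; apply: MP => //; rewrite ltrDl.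
Qed.

Definition lower_Psi1 L f : \bar R :=
  limf_einf (fun tau => (L1 tau L / f tau)%:E) T_infty.

End parametric_minima.

(* Main.v *)
Require Import Defs.
From mathcomp Require Import all_boot all_order all_algebra.
From mathcomp Require Import all_classical all_reals all_analysis.
From mathcomp Require Import perm ring lra.

(** Mahler's transference, up to a constant factor: if the dual of a unimodular
    lattice has a nonzero vector [w] of sup-norm at most [l], then the lattice has
    a nonzero vector, orthogonal to [w], of norm at most a constant times
    [l `^ (d - 1)^-1]. Applied to the lattice deformed by [D_tau^-1], this bounds
    [L1 tau Lambda] by [L1 (- tau) Lambda^* / (d - 1)] plus a constant, which
    disappears after division by [f tau] as [f tau] tends to infinity.

    The constant being irrelevant, Minkowski's linear forms theorem is replaced by
    a weak form of it: column operations with bounded coefficients make the system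
    triangular, a triangular lattice has an axis-parallel box as fundamental
    domain, and the pigeonhole principle is applied to the reductions modulo the
    lattice of the points of a fine grid. *)

Set Implicit Arguments.
Unset Strict Implicit.
Unset Printing Implicit Defensive.

Import Order.TTheory GRing.Theory Num.Theory.
Import numFieldNormedType.Exports.

Local Open Scope classical_set_scope.
Local Open Scope ring_scope.

(** * A weak form of Minkowski's linear forms theorem *)

Section linear_forms.
Context {R : realType}.

(* Pivoting on the largest entry keeps the multipliers bounded by 1. *)
Lemma pivot_trig n (M : 'M[R]_n) : exists Q : 'M[R]_n,
  [/\ is_trig_mx (M *m Q), `|\det Q| = 1 &
      forall (x : 'rV[R]_n) (c : R), (forall i, `|(x *m Q) 0 i| <= c) ->
      forall i, `|x 0 i| <= 2 ^+ n * c].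
Proof.
elim: n M => [|n IHn] M.
  exists 1%:M; split => [||x c _ []//]; last by rewrite det1 normr1.
  by apply/is_trig_mxP => -[].
have [j jmax] : exists j, forall k, `|M 0 k| <= `|M 0 j|.
  have [j _ jP] := @arg_maxP _ R _ (0 : 'I_n.+1) xpredT (fun k => `|M 0 k|) isT.
  by exists j => k; exact: jP.
pose P : 'M[R]_(1 + n) := tperm_mx 0 j.
have [M1 M1def] : exists M1 : 'M[R]_(1 + n), M1 = M *m P by exists (M *m P).
have M1E i k : M1 i k = M i (tperm 0 j k).
  by rewrite M1def /P -xcolE mxE.
pose a := M1 0 0.
(* If the pivot [a] is 0, the whole first row vanishes and [r] is 0 because [0^-1 = 0]; so [a *: r]
   is the rest of that row in every case. *)
pose r : 'rV[R]_n := a^-1 *: ursubmx M1.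
have aE : a = M 0 j by rewrite /a M1E tpermL.
have r1 k : `|r 0 k| <= 1.
  rewrite !mxE M1E normrM normfV aE.
  have [->|a0] := eqVneq (M 0 j) 0; first by rewrite normr0 invr0 mul0r.
  by rewrite mulrC ler_pdivrMr ?normr_gt0// mul1r lshift0 jmax.
have ulE : ulsubmx M1 = a%:M.
  by rewrite [LHS]mx11_scalar !mxE lshift0.
have ar : a *: r = ursubmx M1.
  rewrite /r scalerA; have [a0|a0] := eqVneq a 0; last by rewrite divff// scale1r.
  rewrite a0 mul0r scale0r; apply/matrixP => i k; rewrite !mxE M1E.
  apply/esym/eqP; rewrite -normr_le0 ord1 lshift0.
  by rewrite (le_trans (jmax _))// -aE a0 normr0.
pose E : 'M[R]_(1 + n) := block_mx 1%:M (- r) 0 1%:M.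
have [Q' [trigQ' detQ' bndQ']] := IHn (dlsubmx M1 *m (- r) + drsubmx M1).
pose F : 'M[R]_(1 + n) := block_mx 1%:M 0 0 Q'.
exists (P *m E *m F); split.
- rewrite !mulmxA -M1def -[M1]submxK ulE /E /F !(@mulmx_block R 1 n 1 n 1 n).
  rewrite !mulmx0 !mulmx1 !addr0 !add0r.
  rewrite (@is_trig_block_mx R 1 n 1 n)//.
  rewrite mul_scalar_mx scalerN ar addNr mul0mx eqxx/= trigQ' andbT.
  by apply/is_trig_mxP => i k; rewrite !ord1 ltnn.
- rewrite !det_mulmx !normrM /P /E /F det_perm normrX normrN1 expr1n mul1r.
  by rewrite (@det_ublock R 1 n) (@det_ublock R 1 n) !det1 !mul1r normr1 detQ' mul1r.
- move=> x c xc i.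
  have [y ydef] : exists y : 'rV[R]_(1 + n), y = x *m P by exists (x *m P).
  have yE k : x 0 k = y 0 (tperm 0 j k).
    by rewrite ydef /P -xcolE mxE tpermK.
  have xQ : x *m (P *m E *m F) =
      row_mx (lsubmx y) ((rsubmx y - y 0 0 *: r) *m Q').
    rewrite !mulmxA -ydef -[in LHS](hsubmxK y) /E /F !(@mul_row_block R 1 1 n 1 n).
    rewrite !mulmx1 !mulmx0 !addr0 !add0r; congr (row_mx _ (_ *m _)).
    rewrite addrC [in LHS](mx11_scalar (lsubmx y)) mul_scalar_mx scalerN.
    by rewrite mxE lshift0.
  have y0 : `|y 0 0| <= c.
    by have := xc (@lshift 1 n 0); rewrite xQ (@row_mxEl R 1 1 n) mxE lshift0.
  have c0 : 0 <= c by exact: le_trans y0.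
  (* Induction bounds [rsubmx y - y 0 0 *: r] by [2 ^+ n * c]; adding back [y 0 0 *: r] costs at
     most [c]. *)
  have yk k : `|y 0 (rshift 1 k)| <= 2 ^+ n * c + c.
    have := bndQ' (rsubmx y - y 0 0 *: r) c.
    have Hc i0 : `|((rsubmx y - y 0 0 *: r) *m Q') 0 i0| <= c.
      by have := xc (rshift 1 i0); rewrite xQ (@row_mxEr R 1 1 n).
    move=> /(_ Hc k); rewrite !mxE => H.
    rewrite -[y 0 _](subrK (y 0 0 * (a^-1 * M1 (lshift n 0) (rshift 1 k)))).
    rewrite (le_trans (ler_normD _ _))// lerD// normrM -[leRHS]mulr1 ler_pM//.
    by have := r1 k; rewrite !mxE.
  have n1 : 1 <= (2 : R) ^+ n by rewrite exprn_ege1 // ler1n.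
  have bnd : 2 ^+ n * c + c <= 2 ^+ n.+1 * c.
    by rewrite exprS -mulrA mulr_natl mulr2n lerD2l ler_peMl.
  rewrite yE; have [->|] := eqVneq (tperm 0 j i) 0.
    by rewrite (le_trans y0)// ler_peMl// exprn_ege1// ler1n.
  case: (split_ordP (tperm 0 j i : 'I_(1 + n))) => k ->.
    by rewrite ord1 lshift0 eqxx.
  by move=> _; exact: le_trans (yk k) bnd.
Qed.

(** The first row of a lower triangular [T] only affects the first coordinate. So the other
    coordinates are reduced first, by induction, and a floor then settles the first one. *)
Lemma trig_reduce n (T : 'M[R]_n) : is_trig_mx T -> (forall i, T i i != 0) ->
  forall g : 'rV[R]_n, exists z : 'rV[int]_n,
  forall i, 0 <= (g - map_mx intr z *m T) 0 i / T i i < 1.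
Proof.
elim: n T => [|n IHn] T; first by move=> _ _ g; exists 0 => -[].
have TE := @submxK _ 1 n 1 n T.
rewrite -[X in is_trig_mx X]TE (@is_trig_block_mx R 1 n 1 n)//.
move=> /and3P[/eqP ur0 _ trigT'] T0 g.
have T'0 i : drsubmx (T : 'M[R]_(1 + n)) i i != 0 by rewrite !mxE T0.
have [z' z'P] := IHn _ trigT' T'0 (rsubmx (g : 'rV[R]_(1 + n))).
pose u := g 0 0 - (map_mx intr z' *m dlsubmx (T : 'M[R]_(1 + n))) 0 0.
pose q := Num.floor (u / T 0 0).
exists (row_mx q%:M z' : 'rV[int]_(1 + n)) => i.
rewrite (map_row_mx intr (q%:M : 'M[int]_1) z') -[X in _ *m X]TE ur0.
rewrite (@mul_row_block R 1 1 n 1 n) mulmx0 add0r map_scalar_mx/=.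
case: (split_ordP (i : 'I_(1 + n))) => k ->.
  rewrite ord1 !lshift0 mxE [X in _ + X]mxE.
  have -> : (0 : 'I_n.+1) = @lshift 1 n 0 by rewrite lshift0.
  rewrite (@row_mxEl R 1 1 n).
  rewrite mul_scalar_mx lshift0 [X in _ - X]mxE [X in _ - (X + _)]mxE.
  rewrite [X in _ - (_ * X + _)]mxE [X in _ - (_ * X + _)]mxE lshift0.
  rewrite opprD addrCA addrC -[X in (X + _) / _]/u.
  rewrite mulrBl mulfK//.
  have := floor_itv (u / T 0 0); rewrite -/q intrD => /andP[q1 q2].
  by rewrite subr_ge0 q1 ltrBlDl.
rewrite mxE [X in _ + X]mxE (@row_mxEr R 1 1 n).
have drE : drsubmx (T : 'M[R]_(1 + n)) k k = T (rshift 1 k) (rshift 1 k).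
  by rewrite !mxE.
by have := z'P k; rewrite mxE [rsubmx _ _ _]mxE [X in _ + X]mxE drE.
Qed.


Lemma truncn_eq_dist (x y : R) : 0 <= x -> 0 <= y ->
  Num.truncn x = Num.truncn y -> `|x - y| < 1.
Proof.
move=> /truncn_itv/andP[x1 x2] /truncn_itv/andP[y1 y2] xy.
move: x1 x2 y1 y2; rewrite xy -natr1 ltr_norml => *; lra.
Qed.

(** The [k ^ n] points of a grid of step 1/k in the unit cube are reduced into the fundamental box,
    which is cut into cells with sides shorter than 1/k. There are fewer cells than points, so two
    points share a cell, and the difference of their lattice translations is the short vector. *)
Lemma trig_linear_forms n (T : 'M[R]_n) : is_trig_mx T -> \det T != 0 ->
  `|\det T| < 2^-1 ^+ n ->
  exists2 z : 'rV[int]_n, z != 0 & forall i, `|(map_mx intr z *m T) 0 i| <= 1.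
Proof.
move=> trigT; rewrite (det_trig trigT) => detT0 detT.
have T0 i : T i i != 0 by move/prodf_neq0: detT0; exact.
(* With [k] above every inverse of [|T i i|], rounding up to [(N i).+1] at most doubles
   [k * |T i i|]; the hypothesis on the determinant absorbs these factors 2. *)
pose k := (Num.truncn (\sum_i `|T i i|^-1)).+1.
have k0 : 0 < k%:R :> R by rewrite ltr0n.
have kT i : 1 <= k%:R * `|T i i|.
  rewrite -ler_pdivrMr ?normr_gt0// mul1r.
  have s0 : 0 <= \sum_i `|T i i|^-1 by apply: sumr_ge0 => j _; rewrite invr_ge0.
  apply: (le_trans _ (ltW (andP (truncn_itv s0)).2)).
  by rewrite (bigD1 i)//= lerDl; apply: sumr_ge0 => j _; rewrite invr_ge0.
pose N i := Num.truncn (k%:R * `|T i i|).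
have NP i : k%:R * `|T i i| < (N i).+1%:R <= 2 * (k%:R * `|T i i|).
  have /truncn_itv : 0 <= k%:R * `|T i i| by rewrite (le_trans _ (kT i)).
  rewrite -/(N i) => /andP[N1 ->]/=.
  by rewrite -natr1 mulr_natl mulr2n lerD.
have cards : (\prod_i (N i).+1 < k ^ n)%N.
  rewrite -(ltr_nat R) natrX natr_prod.
  apply: (@le_lt_trans _ _ (\prod_i (2 * (k%:R * `|T i i|)))).
    by apply: ler_prod => i _; rewrite ler0n (andP (NP i)).2.
  rewrite !big_split/= !prodr_const !card_ord mulrCA -normr_prod.
  rewrite gtr_pMr ?exprn_gt0//.
  by move: detT; rewrite exprVn -[_^-1]mul1r ltr_pdivlMr ?exprn_gt0// mulrC.
pose g (h : {ffun 'I_n -> 'I_k}) : 'rV[R]_n := \row_i ((h i)%:R / k%:R).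
have /choice[zf zfP] h := trig_reduce trigT T0 (g h).
pose e h i := (g h - map_mx intr (zf h) *m T) 0 i / T i i.
have eP h i : 0 <= e h i < 1 by exact: zfP.
have cell_lt h i : (Num.truncn ((N i).+1%:R * e h i) < (N i).+1)%N.
  have /andP[e0 e1] := eP h i.
  have Ne0 : 0 <= (N i).+1%:R * e h i by rewrite mulr_ge0.
  by rewrite (truncn_lt_nat _ Ne0) gtr_pMr// ltr0n.
pose cell h : {dffun forall i : 'I_n, 'I_(N i).+1} :=
  [ffun i : 'I_n => inord (Num.truncn ((N i).+1%:R * e h i)) : 'I_(N i).+1].
have /injectivePn[h [h' hh' ehh']] : ~~ injectiveb cell.
  apply/negP => /injectiveP/leq_card; rewrite card_ffun !card_ord card_dep_ffun.
  rewrite leqNgt => /negP; apply.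
  rewrite foldrE big_map big_enum/=.
  by under eq_bigr do rewrite card_ord.
have ee i : `|(e h i - e h' i) * T i i| < k%:R^-1.
  have /(congr1 (fun c : {dffun forall i : 'I_n, 'I_(N i).+1} => val (c i))) := ehh'.
  rewrite !ffunE /= !inordK//.
  have /andP[e0 _] := eP h i; have /andP[e'0 _] := eP h' i.
  move=> /(truncn_eq_dist (mulr_ge0 (ler0n _ _) e0) (mulr_ge0 (ler0n _ _) e'0)).
  rewrite -mulrBr !normrM normr_nat => H.
  have Ti : 0 < `|T i i| by rewrite normr_gt0.
  rewrite -[ltRHS]mul1r ltr_pdivlMr// -mulrA mulrC (mulrC _ k%:R).
  apply: le_lt_trans H.
  by rewrite ler_wpM2r// ltW//; case/andP: (NP i).
have geT i : (map_mx intr (zf h - zf h') *m T) 0 i =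
    ((h i)%:R - (h' i)%:R) / k%:R - (e h i - e h' i) * T i i.
  rewrite [X in _ = _ - X]mulrBl /e !divfK// map_mxB mulmxBl !mxE; ring.
exists (zf h - zf h').
  (* If the translations agreed, the grid points would differ by less than 1/k in each coordinate,
     hence coincide. *)
  apply: contra hh' => /eqP zz; apply/eqP/ffunP => i; apply/val_inj.
  have := geT i; rewrite zz map_mx0 mul0mx mxE.
  move=> /esym/eqP; rewrite subr_eq0 => /eqP hi.
  have := ee i; rewrite -hi normrM normfV normr_nat.
  rewrite -[ltRHS]mul1r ltr_pM2r ?invr_gt0//.
  have [hl|hl] := leqP (h i) (h' i).
    rewrite distrC -natrB// normr_nat ltrn1 ltnS leqn0 subn_eq0 => h'l.
    by apply/eqP; rewrite eqn_leq hl.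
  by rewrite -natrB ?(ltnW hl)// normr_nat ltrn1 ltnS leqn0 subn_eq0 leqNgt hl.
move=> i; rewrite geT (le_trans (ler_normB _ _))//.
have : `|(h i)%:R - (h' i)%:R| <= k%:R - 1 :> R.
  have h1 : (h i)%:R <= k%:R - 1 :> R by rewrite lerBrDr natr1 ler_nat.
  have h2 : (h' i)%:R <= k%:R - 1 :> R by rewrite lerBrDr natr1 ler_nat.
  have := ler0n R (h i); have := ler0n R (h' i).
  by move=> *; rewrite ler_norml; lra.
rewrite -(ler_pM2r (x := k%:R^-1)) ?invr_gt0// mulrBl divff ?gt_eqF// mul1r => H.
rewrite normrM normfV normr_nat.
by rewrite (le_trans (lerD H (ltW (ee i))))// subrK.
Qed.

(** Column operations do not touch the integer vector: the [z] found for the triangular [M *m Q]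
    serves for [M], with the loss [2 ^+ n] from [pivot_trig]. *)
Lemma minkowski_linear_forms n (M : 'M[R]_n) : \det M != 0 -> `|\det M| < 2^-1 ^+ n ->
  exists2 z : 'rV[int]_n, z != 0 &
    forall i, `|(map_mx intr z *m M) 0 i| <= 2 ^+ n.
Proof.
move=> M0 M1; have [Q [trigQ detQ bndQ]] := pivot_trig M.
have detE : `|\det (M *m Q)| = `|\det M| by rewrite det_mulmx normrM detQ mulr1.
have [||z z0 zP] := trig_linear_forms trigQ.
- by rewrite -normr_eq0 detE normr_eq0.
- by rewrite detE.
exists z => // i; rewrite -[leRHS]mulr1; apply: bndQ => k.
by rewrite -mulmxA.
Qed.

End linear_forms.

(** * Short lattice vectors orthogonal to an integral form *)

Section transference.
Context {R : realType}.

(** Row [j] vanishes off the diagonal, and deleting row and column [j] leaves a scalar matrix. This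
    is the system of forms used in [short_orthogonal]. *)
Lemma det_replace_col n (w : 'rV[R]_n.+1) (j : 'I_n.+1) (s : R) :
  \det (\matrix_(i, k) (if k == j then w 0 i else (i == k)%:R * s))
  = w 0 j * s ^+ n.
Proof.
rewrite (expand_det_row _ j) (bigD1 j)//= big1 => [|k kj]; last first.
  by rewrite mxE (negbTE kj) eq_sym (negbTE kj) !mul0r.
rewrite addr0 mxE eqxx; congr (_ * _).
rewrite /cofactor addnn -mul2n exprM sqrrN !expr1n mul1r.
rewrite (_ : row' _ _ = s%:M) ?det_scalar//.
apply/matrixP => i k; rewrite !mxE eq_sym (negbTE (neq_lift _ _)).
by rewrite (inj_eq lift_inj) mulr_natl.
Qed.

(* If the form [<_, w>] is integral on the lattice, then [|<x, w>| < 1] forces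
   [<x, w> = 0], and the coordinate [j] where [|w j|] is largest is then
   controlled by the other ones. So the linear forms theorem is applied to the
   coordinates other than [j], scaled by [r^-1], and to a multiple of [<_, w>]. *)
Lemma short_orthogonal n (A : 'M[R]_n.+1) (w : 'rV[R]_n.+1) (l r : R) :
  `|\det A| = 1 -> w != 0 ->
  (forall z : 'rV[int]_n.+1,
     \sum_i (map_mx intr z *m A) 0 i * w 0 i \is a Num.int) ->
  (forall i, `|w 0 i| <= l) -> 0 < r -> 2 ^+ (2 * n + 4) * l <= r ^+ n ->
  exists2 z : 'rV[int]_n.+1, z != 0 &
    forall i, `|(map_mx intr z *m A) 0 i| <= n.+1%:R * 2 ^+ n.+1 * r.
Proof.
move=> detA w0 wint wl r0 rl.
have [j jmax] : exists j, forall k, `|w 0 k| <= `|w 0 j|.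
  have [j _ jP] := @arg_maxP _ R _ (0 : 'I_n.+1) xpredT (fun k => `|w 0 k|) isT.
  by exists j => k; exact: jP.
have wj0 : 0 < `|w 0 j|.
  rewrite lt0r normr_ge0 andbT; apply: contra w0 => /eqP wj.
  apply/eqP/rowP => k; rewrite mxE; apply/eqP; rewrite -normr_le0.
  by rewrite (le_trans (jmax k))// wj.
(* [K] is twice the bound [2 ^+ n.+1] of the linear forms theorem, so that the integer [<x, w>] is
   at most 1/2 in absolute value. *)
have [K KE] : exists K : R, K = 2 ^+ n.+2 by exists (2 ^+ n.+2).
have K0 : 0 < K by rewrite KE exprn_gt0.
pose P : 'M[R]_n.+1 :=
  \matrix_(i, k) (if k == j then (K *: w) 0 i else (i == k)%:R * r^-1).
have detP : `|\det (A *m P)| = K * `|w 0 j| / r ^+ n.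
  rewrite det_mulmx normrM detA mul1r det_replace_col mxE !normrM exprVn normfV.
  by rewrite (gtr0_norm K0) normrX (gtr0_norm r0).
have [||z z0 zP] := @minkowski_linear_forms R _ (A *m P).
- rewrite -normr_eq0 detP mulf_neq0// ?invr_eq0 ?gt_eqF// ?exprn_gt0//.
  by rewrite mulr_gt0.
- rewrite detP ltr_pdivrMr ?exprn_gt0// exprVn [ltRHS]mulrC ltr_pdivlMr ?exprn_gt0//.
  (* The exponent [2 * n + 4] is [n + 2] from [K], [n + 1] from the determinant condition, and 1 for
     strictness. *)
  apply: lt_le_trans rl.
  have -> : K * `|w 0 j| * 2 ^+ n.+1 = 2 ^+ (2 * n + 3) * `|w 0 j|.
    rewrite KE mulrAC -exprD; congr (2 ^+ _ * _).
    by rewrite mul2n -addnn !addSn !addnS addn0.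
  apply: (@lt_le_trans _ _ (2 ^+ (2 * n + 4) * `|w 0 j|)).
    by rewrite ltr_pM2r// ltr_eXn2l// ?ltr1n// ltn_add2l.
  by rewrite ler_pM2l ?exprn_gt0.
exists z => //; set x := map_mx intr z *m A in zP *.
have xE k : k != j -> `|x 0 k| <= 2 ^+ n.+1 * r.
  move=> kj; have := zP k; rewrite mulmxA -/x mxE (bigD1 k)//= big1 => [|i ik].
    by rewrite [P _ _]mxE (negbTE kj) eqxx mul1r addr0 normrM normfV
               (gtr0_norm r0) ler_pdivrMr.
  by rewrite [P _ _]mxE (negbTE kj) (negbTE ik) mul0r mulr0.
have xw : \sum_i x 0 i * w 0 i = 0.
  have := zP j; rewrite mulmxA -/x mxE.
  under eq_bigr do rewrite [P _ _]mxE eqxx [X in _ * X]mxE mulrCA.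
  rewrite -mulr_sumr normrM (gtr0_norm K0) KE exprS -mulrA mulrCA.
  rewrite ger_pMr ?exprn_gt0// => xw.
  have /intrP[m mE] := wint z; rewrite -/x in mE.
  have : (2 * `|m|)%:~R <= 1%:~R :> R by rewrite intrM intr_norm -mE.
  rewrite ler_int => m1; rewrite mE.
  suff -> : m = 0 by [].
  by apply/eqP; rewrite -normr_eq0; move: m1 (normr_ge0 m); case: `|m| => [[|[|p]]|].
have ge0 : 0 <= 2 ^+ n.+1 * r by rewrite mulr_ge0// ?ltW// exprn_gt0.
have xj : `|x 0 j| <= n%:R * (2 ^+ n.+1 * r).
  move: xw; rewrite (bigD1 j)//= => /eqP; rewrite addr_eq0 => /eqP xw.
  rewrite -(ler_pM2r wj0) -normrM xw normrN.
  rewrite (le_trans (ler_norm_sum _ _ _))//.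
  apply: (@le_trans _ _ (\sum_(i | i != j) (2 ^+ n.+1 * r * `|w 0 j|))).
    by apply: ler_sum => i ij; rewrite normrM ler_pM// xE.
  by rewrite sumr_const cardC1 card_ord/= -[leLHS]mulr_natl mulrA.
move=> i; rewrite -mulrA.
have [->|ij] := eqVneq i j.
  by rewrite (le_trans xj)// ler_wpM2r// ler_nat.
by rewrite (le_trans (xE _ ij))// ler_peMl// ler1n.
Qed.

(** * Scaled boxes and positivity of the first minimum *)

Section box.
Context {d : nat}.
Implicit Types (tau v : 'rV[R]_d) (L : set 'rV[R]_d).

Lemma unit_boxP v : unit_box v <-> forall i, `|v 0 i| <= 1.
Proof.
rewrite /unit_box /= [X in X <= _](mx_normrE v); split=> [/bigmax_leP[_ v1] i|v1].
  exact: (v1 (0, i)).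
by apply/bigmax_leP; split => // -[i k] _ /=; rewrite ord1.
Qed.

Lemma scaled_boxP tau (l : R) v : 0 < l ->
  [set l *: x | x in box tau] v <-> forall i, `|v 0 i| <= l * expR (tau 0 i).
Proof.
move=> l0; split => [[_ [x /unit_boxP x1 <-] <-] i|vl].
  rewrite /D_mx mul_mx_diag !mxE normrM gtr0_norm// ler_pM2l// normrM.
  by rewrite (gtr0_norm (expR_gt0 _)) ler_piMl// expR_ge0.
have lt0 i : 0 < l * expR (tau 0 i) by rewrite mulr_gt0// expR_gt0.
exists (l^-1 *: v); last by rewrite scalerA divff ?gt_eqF// scale1r.
exists (\row_i (v 0 i / (l * expR (tau 0 i)))).
  apply/unit_boxP => i; rewrite mxE normrM normfV (gtr0_norm (lt0 i)).
  by rewrite ler_pdivrMr// mul1r.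
apply/rowP => i; rewrite /D_mx mul_mx_diag !mxE.
by field; rewrite !gt_eqF// expR_gt0.
Qed.

(** [inf] has a default value on the empty set, so lower bounds pass to [lambda1] only once this set
    is known to be nonempty. *)
Lemma box_multiple_nonempty tau L v : L v -> v != 0 ->
  [set l : R | 0 < l /\ exists v, [/\ L v, v != 0 & [set l *: x | x in box tau] v]]
    !=set0.
Proof.
move=> Lv v0; pose S := \sum_i `|v 0 i| / expR (tau 0 i).
have t0 i : 0 <= `|v 0 i| / expR (tau 0 i) by rewrite divr_ge0// expR_ge0.
have S0 : 0 < S + 1 by rewrite ltr_wpDl// sumr_ge0.
exists (S + 1); split => //; exists v; split => //.
apply/scaled_boxP => // i; rewrite -ler_pdivrMr ?expR_gt0//.
rewrite ler_wpDr// /S (bigD1 i)//= lerDl; exact: sumr_ge0.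
Qed.

Lemma lambda1_le (K L : set 'rV[R]_d) (l : R) v : 0 < l -> L v -> v != 0 ->
  [set l *: x | x in K] v -> lambda1 K L <= l.
Proof.
move=> l0 Lv v0 Kv; apply: ge_inf; last by split => //; exists v.
by exists 0 => m [/ltW].
Qed.

End box.

(** The integer coordinates of a lattice vector in the box scaled by [l] are at most [l * S] in
    absolute value, and a nonzero one is at least 1. Positivity makes [ln] in [L1] a genuine
    logarithm. *)
Lemma lambda1_box_gt0 n (L : set 'rV[R]_n.+1) tau : is_lattice L ->
  0 < lambda1 (box tau) L.
Proof.
move=> [B [Bu LE]].
pose N := D_mx tau *m invmx B.
pose S := 1 + \sum_k \sum_i `|N k i|.
have sum0 : 0 <= \sum_k \sum_i `|N k i| by do 2![apply: sumr_ge0 => *].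
have S0 : 0 < S by rewrite ltr_pwDl.
apply: (@lt_le_trans _ _ S^-1); first by rewrite invr_gt0.
apply: lb_le_inf.
  apply: (@box_multiple_nonempty _ tau L (row 0 B)).
    by rewrite LE; exists (delta_mx 0 0) => //; rewrite map_delta_mx rowE.
  apply: contraTneq Bu => B0; rewrite -row_free_unit.
  apply/negP => /row_freeP[C BC].
  have := congr1 (fun M : 'M[R]_n.+1 => row 0 M 0 0) BC.
  by rewrite /= row_mul B0 mul0mx !mxE eqxx => /esym/eqP; rewrite oner_eq0.
move=> l [l0 [v [Lv v0 [_ [x /unit_boxP x1 <-] vE]]]].
rewrite -[_^-1]mul1r ler_pdivrMr//.
move: Lv v0; rewrite LE => -[z _ zv] v0.
have [i zi] : exists i, z 0 i != 0.
  apply/existsP; apply: contra_neqT v0; rewrite negb_exists => /forallP z0.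
  rewrite -zv (_ : z = 0) ?map_mx0 ?mul0mx//; apply/rowP => i.
  by rewrite mxE; apply/eqP/negPn.
have zE : map_mx intr z = l *: (x *m N) :> 'rV[R]_n.+1.
  by rewrite /N mulmxA scalemxAl vE -zv mulmxK.
have : 1 <= `|(z 0 i)%:~R| :> R by rewrite -intr_norm ler1z -gtz0_ge1 normr_gt0.
have -> : (z 0 i)%:~R = l * (x *m N) 0 i by have /rowP/(_ i) := zE; rewrite !mxE.
move=> /le_trans; apply; rewrite normrM gtr0_norm// ler_pM2l//.
rewrite mxE (le_trans (ler_norm_sum _ _ _))// /S.
rewrite ler_wpDl//; apply: ler_sum => k _; rewrite normrM.
apply: (@le_trans _ _ `|N k i|); first by rewrite ler_piMl.
by rewrite (bigD1 i)//= lerDl; apply: sumr_ge0 => *.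
Qed.

(** * Transference for the first minimum and its logarithm *)

Lemma mulmx_D_mxN m n (A : 'M[R]_(m, n)) (tau : 'rV[R]_n) i j :
  (A *m D_mx (- tau)) i j = A i j / expR (tau 0 j).
Proof. by rewrite /D_mx mul_mx_diag !mxE expRN. Qed.

Lemma T_spaceN n (tau : 'rV[R]_n) : T_space tau -> T_space (- tau).
Proof.
rewrite /T_space /=; under [in X in _ -> X]eq_bigr do rewrite mxE.
by rewrite sumrN => ->; rewrite oppr0.
Qed.

Lemma D_mx_det n (tau : 'rV[R]_n) : T_space tau -> \det (D_mx tau) = 1.
Proof.
rewrite /T_space /= => T0; rewrite det_diag.
by under eq_bigr do rewrite mxE; rewrite -expR_sum T0 expR0.
Qed.

(** Applying [D_mx (- tau)] to the lattice and [D_mx tau] to the dual vector preserves their pairing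
    and the determinant, and turns both boxes into cubes, as [short_orthogonal] requires. *)
Lemma lambda1_transference n (L : set 'rV[R]_n.+1) tau (l r : R) :
  unimodular L -> T_space tau -> 0 < l ->
  (exists v, [/\ dual_lattice L v, v != 0 &
     [set l *: x | x in box (- tau)] v]) ->
  0 < r -> 2 ^+ (2 * n + 4) * l <= r ^+ n ->
  lambda1 (box tau) L <= n.+1%:R * 2 ^+ n.+1 * r.
Proof.
move=> [[B BL] covL] Ttau l0 [y [Ly y0 /(scaled_boxP _ _ l0) yl]] r0 rl.
have detB : `|\det B| = 1 by rewrite -(covolumeE BL).
have TNtau : T_space (- tau) by exact: T_spaceN.
have [_ LE] := BL.
have [||||z z0 zP] := @short_orthogonal n (B *m D_mx (- tau))
    (\row_i (y 0 i * expR (tau 0 i))) l r _ _ _ _ r0 rl.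
- by rewrite det_mulmx D_mx_det// mulr1.
- apply: contra y0 => /eqP/rowP yE; apply/eqP/rowP => i.
  have /eqP := yE i; rewrite !mxE mulf_eq0 [X in _ || X]gt_eqF ?expR_gt0// orbF.
  by move/eqP.
- move=> z; have LzB : L (map_mx intr z *m B) by rewrite LE; exists z.
  rewrite (eq_bigr (fun i => y 0 i * (map_mx intr z *m B) 0 i)) ?Ly// => i _.
  rewrite mulmxA mulmx_D_mxN [X in _ * X = _]mxE.
  by field; rewrite gt_eqF// expR_gt0.
- move=> i; have := yl i; rewrite !mxE expRN ler_pdivlMr ?expR_gt0//.
  by rewrite normrM (gtr0_norm (expR_gt0 _)).
have c0 : 0 < n.+1%:R * 2 ^+ n.+1 * r.
  by rewrite !mulr_gt0// ?exprn_gt0// ltr0n.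
apply: (@lambda1_le _ _ _ _ (map_mx intr z *m B)) => //.
- by rewrite LE; exists z.
- apply: contra z0 => /eqP zB; apply/eqP/rowP => i.
  have : map_mx intr z *m B *m invmx B = 0 :> 'rV[R]_n.+1 by rewrite zB mul0mx.
  rewrite mulmxK; last by case: BL.
  by move=> /rowP/(_ i); rewrite !mxE => /eqP; rewrite intr_eq0 => /eqP.
apply/scaled_boxP => // i; have := zP i.
rewrite mulmxA mulmx_D_mxN.
by rewrite normrM normfV (gtr0_norm (expR_gt0 _)) ler_pdivrMr// expR_gt0.
Qed.

Lemma dual_lattice_neq0 n (L : set 'rV[R]_n.+1) : is_lattice L ->
  exists2 v, dual_lattice L v & v != 0.
Proof.
move=> [B [Bu ->]]; exists (row 0 (invmx B)^T).
  move=> _ [z _ <-]; apply/intrP; exists (z 0 0).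
  have <- : (map_mx intr z *m B *m invmx B) 0 0 = (z 0 0)%:~R :> R.
    by rewrite mulmxK// mxE.
  by rewrite [RHS]mxE; apply: eq_bigr => i _; rewrite !mxE mulrC.
apply/eqP => /(congr1 (fun v => (v *m B^T) 0 0)).
rewrite -row_mul -trmx_mul mulmxV// trmx1 mul0mx !mxE eqxx.
by move/eqP; rewrite oner_eq0.
Qed.

(** Each [l] competing in the dual minimum gives, with [r ^+ n = k * l], the bound [c * r] on the
    first minimum of [L]. Solved for [l], this reads [m <= l], so [m] bounds the infimum, and
    logarithms are taken. *)
Lemma L1_transference n (L : set 'rV[R]_n.+1) : (0 < n)%N -> unimodular L ->
  exists C : R, forall tau, T_space tau ->
    L1 tau L <= L1 (- tau) (dual_lattice L) / n%:R + C.
Proof.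
move=> n0 uL; have nR : 0 < n%:R :> R by rewrite ltr0n.
pose c : R := n.+1%:R * 2 ^+ n.+1; pose k : R := 2 ^+ (2 * n + 4).
have c0 : 0 < c by rewrite mulr_gt0// ?exprn_gt0// ltr0n.
have k0 : 0 < k by rewrite exprn_gt0.
exists (ln c + ln k / n%:R) => tau Ttau.
have la0 : 0 < lambda1 (box tau) L by apply: lambda1_box_gt0; case: uL.
have [v Lv v0] := dual_lattice_neq0 uL.1.
pose m := (lambda1 (box tau) L / c) ^+ n / k.
have m0 : 0 < m by rewrite divr_gt0// exprn_gt0// divr_gt0.
have : m <= lambda1 (box (- tau)) (dual_lattice L).
  apply: lb_le_inf; first exact: (box_multiple_nonempty _ Lv v0).
  move=> l [l0 lP]; have kl0 : 0 < k * l by rewrite mulr_gt0.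
  pose r := expR (ln (k * l) / n%:R).
  have rE : r ^+ n = k * l.
    by rewrite -expRM_natl mulrCA divff ?gt_eqF// mulr1 lnK.
  have := @lambda1_transference _ L tau l r uL Ttau l0 lP (expR_gt0 _).
  rewrite rE => /(_ (lexx _)); rewrite -/c => lac.
  rewrite ler_pdivrMr// [leRHS]mulrC -rE.
  apply: lerXn2r; rewrite ?nnegrE ?expR_ge0//; first by rewrite divr_ge0// ltW.
  by rewrite ler_pdivrMr// mulrC.
move=> mle; have : ln m <= L1 (- tau) (dual_lattice L).
  by rewrite ler_ln// posrE (lt_le_trans m0).
rewrite /m ln_div ?posrE ?exprn_gt0 ?divr_gt0// lnXn ?divr_gt0// ln_div ?posrE//.
rewrite -/(L1 tau L) => H.
rewrite -lerBlDr -(ler_pM2r nR) divfK ?gt_eqF//.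
apply: le_trans H; rewrite -mulr_natr le_eqVlt; apply/orP; left; apply/eqP.
by rewrite -/(L1 tau L); field; rewrite gt_eqF.
Qed.

End transference.

(** * Passage to the lower limit *)

Lemma lower_Psi1_le_div {R : realType} n (L L' : set 'rV[R]_n) (f : 'rV[R]_n -> R)
    (k C : R) : 0 < k -> admissible f ->
  (forall tau, T_space tau -> L1 tau L <= L1 (- tau) L' / k + C) ->
  (lower_Psi1 L f <= lower_Psi1 L' (fun tau => f (- tau)%R) * k^-1%:E)%E.
Proof.
move=> k0 /admissibleP[_ fb _] LL'.
rewrite /lower_Psi1 limf_einfE; apply: ge_ereal_sup => _ [V TV <-].
(* The infimum over [V] is compared, up to [e], with the one over a tail [W] on which [- tau] lies
   in [V] and [f (- tau)] exceeds [|C| / e], so that [C] contributes at most [e]. *)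
apply/lee_addgt0Pr => e e0; rewrite -leeBlDr// lee_pdivlMr// limf_einfE.
have [M MP] := fb (`|C| / e).
have [N _ NP] := TV.
pose W := [set tau : 'rV[R]_n | T_space tau /\ Num.max M N < `|tau|].
apply: (@le_trans _ _ (ereal_inf
    [set (L1 tau L' / f (- tau))%:E | tau in W])); last first.
  by apply: ereal_sup_ubound; exists W => //; exists (Num.max M N).
apply: le_ereal_inf_tmp => _ [tau [Ttau]] + <-.
rewrite gt_max => /andP[Mtau Ntau].
have TN : T_space (- tau) by exact: T_spaceN.
have VN : V (- tau) by apply: NP; split => //; rewrite normrN.
have fC : `|C| / e < f (- tau) by apply: MP => //; rewrite normrN.
have f0 : 0 < f (- tau) by rewrite (le_lt_trans _ fC)// divr_ge0// ltW.
rewrite -lee_pdivlMr// leeBlDr//.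
apply: (@le_trans _ _ (L1 (- tau) L / f (- tau))%:E).
  by apply: ereal_inf_lbound; exists (- tau).
rewrite -EFinM -EFinD lee_fin ler_pdivrMr// mulrDl.
have -> : L1 tau L' / f (- tau) / k * f (- tau) = L1 tau L' / k.
  by field; rewrite !gt_eqF.
have := LL' _ TN; rewrite opprK => /le_trans; apply; rewrite lerD2l.
by rewrite (le_trans (ler_norm C))// mulrC -ler_pdivrMr// ltW.
Qed.

Theorem theorem6 (R : realType) (d : nat) (hd : (2 <= d)%N)
    (Lambda : set 'rV[R]_d) (hLambda : unimodular Lambda)
    (f : 'rV[R]_d -> R) (hf : admissible f) :
  (lower_Psi1 Lambda f <=
     lower_Psi1 (dual_lattice Lambda) (fun tau => f (- tau)%R)
       / (d%:R - 1)%:E)%E.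
Proof.
case: d hd Lambda hLambda f hf => // n n0 L uL f hf.
have nR : 0 < n%:R :> R by rewrite ltr0n.
have [C CP] := L1_transference n0 uL.
(* Here [n] is [d - 1]; as it is nonzero, its inverse in the extended reals is the real one. *)
rewrite -natr1 addrK inver gt_eqF//.
exact: lower_Psi1_le_div hf CP.
Qed.
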